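(* Let $\Omega=\mathbb{R}^3\setminus\bar B(0,1)$, let $E>0$, and let $0<\eta_1\ll\eta_0\ll1$ be small constants ($\eta_0$ sufficiently small depending on $E$, and $\eta_1$ sufficiently small depending on $E$ and $\eta_0$). Let $u$ be a spherically symmetric $\dot H_0^1(\Omega)$ solution of $i\partial_tu+\Delta u=|u|^4u$, $u|_{\partial\Omega}=0$, on a compact interval $[t_-,t_+]$ with energy at most $E$, and let $[t_-,t_+]=\bigcup_{j=1}^JI_j$ be a decomposition into consecutive intervals with $\eta_0<\|u\|_{L^{10}_{t,x}(I_j\times\Omega)}\le2\eta_0$ for each $j$. If $I$ is an unexceptional interval among the $I_j$, then $$|I|>\eta_1 .$$
   Context: All functions are complex-valued and spherically symmetric (radial), $f=f(r)$, $r=|x|\ge1$. The (radial) space $\dot H_0^1(\Omega)$ consists of radial functions $f$ that are (locally) absolutely continuous on $[1,\infty)$ with $f(1)=0$ and $\|f'\|_{L^2(r^2dr)}+\|f\|_{L^6(r^2dr)}<\infty$, normed by $\|f\|_{\dot H_0^1}=\|\nabla f\|_{L^2}$ (up to a fixed normalization). $\Delta_D$ is the Dirichlet Laplacian on $\Omega$ and $e^{it\Delta_D}$ is the free Schrödinger propagator, extended by continuity from radial $L^2\cap\dot H_0^1$ to an isometric group on radial $\dot H_0^1(\Omega)$. A solution on a time interval $I$ is a radial function $u\in C^0_t\dot H_0^1(I\times\Omega)$ satisfying, for all $t_0,t_1\in I$, $$u(t_1)=e^{i(t_1-t_0)\Delta_D}u(t_0)-i\int_{t_0}^{t_1}e^{i(t_1-t)\Delta_D}\bigl(|u|^4u\bigr)(t)\,dt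 .$$ Its energy is the conserved quantity $\frac12\int_\Omega|\nabla u|^2dx+\frac16\int_\Omega|u|^6dx$. Exceptional/unexceptional intervals: let $u_\pm(t)=e^{i(t-t_\pm)\Delta_D}u(t_\pm)$. An interval $I_j$ of the decomposition is exceptional if $\|u_+\|_{L^{10}_{t,x}(I_j\times\Omega)}>\eta_0^{10}$ or $\|u_-\|_{L^{10}_{t,x}(I_j\times\Omega)}>\eta_0^{10}$; it is unexceptional if $\|u_\pm\|_{L^{10}_{t,x}(I_j\times\Omega)}\le\eta_0^{10}$ for both signs. *)

(* Defs.v *)
From HB Require Import structures.
From mathcomp Require Import all_boot all_order all_algebra.
From mathcomp Require Import all_classical all_reals all_analysis.
From mathcomp Require Export complex.

Set Implicit Arguments.
Unset Strict Implicit.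
Unset Printing Implicit Defensive.

Import Order.TTheory GRing.Theory Num.Theory.
Import numFieldNormedType.Exports.

Local Open Scope classical_set_scope.
Local Open Scope complex_scope.
Local Open Scope ring_scope.

(* Omega is the exterior of the closed unit ball of R^3.  A radial function on
   Omega is represented by its profile [f : R -> R[i]], of which only the
   values at radii r >= 1 are meaningful. *)

Section Radial.
Context {R : realType}.
Implicit Types (f g h : R -> R[i]) (t r : R).

Local Notation mu := (@lebesgue_measure R).

Definition imag : R[i] := 0 +i* 1.

Definition cnorm (z : R[i]) : R := ComplexField.Normc.normc z.

Definition radii : set R := `[1, +oo[.

(* Lebesgue measure on Omega in polar coordinates: dx = 4 pi r^2 dr. *)
Definition integral_Omega (k : R -> R) : \bar R :=
  (\int[mu]_(r in radii) (4 * pi * r ^+ 2 * k r)%:E)%E.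

Definition Lnorm_Omega (p : nat) f : \bar R :=
  (integral_Omega (fun r => (cnorm (f r) ^+ p)%R) `^ (p%:R^-1)%R)%E.

Definition cintegral (D : set R) f : R[i] :=
  (\int[mu]_(x in D) complex.Re (f x)) +i* (\int[mu]_(x in D) complex.Im (f x)).

Definition inner_Omega f g : R[i] :=
  cintegral radii (fun r => (4 * pi * r ^+ 2)%:C * (f r * (g r)^*)).

(* The radial derivative; the junk value of [derive1] at points where f is not
   differentiable is harmless, as it is only used almost everywhere. *)
Definition cderive f : R -> R[i] := fun r =>
  derive1 (fun x => complex.Re (f x)) r +i* derive1 (fun x => complex.Im (f x)) r.

Definition abs_cont (a b : R) f : Prop :=
  forall e : R, 0 < e -> exists2 d : R, 0 < d &
    forall (n : nat) (x y : 'I_n -> R),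
      (forall k, a <= x k /\ x k <= y k /\ y k <= b) ->
      trivIset setT (fun k => `]x k, y k[%classic) ->
      \sum_k (y k - x k) < d ->
      \sum_k cnorm (f (y k) - f (x k)) < e.

Definition loc_abs_cont f : Prop := forall b : R, 1 < b -> abs_cont 1 b f.

Definition in_L2 f : Prop :=
  [/\ measurable_fun radii (fun r => complex.Re (f r)),
      measurable_fun radii (fun r => complex.Im (f r)) &
      (Lnorm_Omega 2 f < +oo)%E].

Definition in_dotH10 f : Prop :=
  [/\ loc_abs_cont f, f 1 = 0, (Lnorm_Omega 2 (cderive f) < +oo)%E &
      (Lnorm_Omega 6 f < +oo)%E].

Definition dotH10_norm f : \bar R := Lnorm_Omega 2 (cderive f).

(* [dirichlet_laplacian f h]: f is in the domain of Delta_D and Delta_D f = h,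
   where - Delta_D is the self-adjoint operator of the Dirichlet form on
   H^1_0 = L^2 `&` dot H^1_0.  For radial f, h testing against radial functions
   is enough. *)
Definition dirichlet_laplacian f h : Prop :=
  [/\ in_L2 f, in_dotH10 f, in_L2 h &
      forall phi, in_L2 phi -> in_dotH10 phi ->
        inner_Omega (cderive f) (cderive phi) = - inner_Omega h phi].

(* e^{it Delta_D} is built in three steps.  On the domain of Delta_D it is given
   by the L^2-differentiable solution of v' = i Delta_D v (unique by
   conservation of the L^2 norm, existing by Stone's theorem); it is extended
   by density to L^2, and by continuity from L^2 `&` dot H^1_0 to dot H^1_0. *)
Definition schrodinger_orbit (v : R -> R -> R[i]) : Prop :=
  exists w : R -> R -> R[i], forall t,
    dirichlet_laplacian (v t) (w t) /\
    Lnorm_Omega 2 (fun r => (s^-1)%:C * (v (t + s) r - v t r) - imag * w t r)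
      @[s --> 0^'] --> 0%E.

Definition propagates_dom t f g : Prop :=
  exists2 v, schrodinger_orbit v &
    forall r, 1 <= r -> v 0 r = f r /\ v t r = g r.

Definition propagates_L2 t f g : Prop :=
  [/\ in_L2 f, in_L2 g &
      exists fn gn : nat -> R -> R[i],
        [/\ forall n, propagates_dom t (fn n) (gn n),
            Lnorm_Omega 2 (fn n \- f) @[n --> \oo] --> 0%E &
            Lnorm_Omega 2 (gn n \- g) @[n --> \oo] --> 0%E]].

Definition propagates t f g : Prop :=
  [/\ in_dotH10 f, in_dotH10 g &
      exists fn gn : nat -> R -> R[i],
        [/\ forall n, in_dotH10 (fn n) /\ in_dotH10 (gn n),
            forall n, propagates_L2 t (fn n) (gn n),
            dotH10_norm (fn n \- f) @[n --> \oo] --> 0%E &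
            dotH10_norm (gn n \- g) @[n --> \oo] --> 0%E]].

(* The g with [propagates t f g] exists and is unique on [radii] for every f in
   dot H^1_0; values at radii below 1 are irrelevant. *)
Definition exp_it_Delta t f : R -> R[i] :=
  xget (fun=> 0) [set g | propagates t f g].

Definition oriented_cintegral (a b : R) f : R[i] :=
  if a <= b then cintegral `[a, b] f else - cintegral `[b, a] f.

Definition quintic f : R -> R[i] := fun r => (cnorm (f r) ^+ 4)%:C * f r.

Definition continuous_dotH10 (I : set R) (u : R -> R -> R[i]) : Prop :=
  forall t, I t -> in_dotH10 (u t) /\
    dotH10_norm (u s \- u t) @[s --> within I (nbhs t)] --> 0%E.

(* The dot H^1_0-valued integral is evaluated pointwise in r, point evaluations
   being continuous on the radial space dot H^1_0. *)
Definition is_solution (I : set R) (u : R -> R -> R[i]) : Prop :=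
  continuous_dotH10 I u /\
  forall t0 t1, I t0 -> I t1 -> forall r, 1 <= r ->
    u t1 r = exp_it_Delta (t1 - t0) (u t0) r -
      imag * oriented_cintegral t0 t1
             (fun t => exp_it_Delta (t1 - t) (quintic (u t)) r).

Definition energy f : \bar R :=
  ((2^-1)%:E * integral_Omega (fun r => (cnorm (cderive f r) ^+ 2)%R) +
   (6^-1)%:E * integral_Omega (fun r => (cnorm (f r) ^+ 6)%R))%E.

Definition L10_norm (I : set R) (u : R -> R -> R[i]) : \bar R :=
  ((\int[mu]_(t in I) integral_Omega (fun r => (cnorm (u t r) ^+ 10)%R))
     `^ 10^-1)%E.

Definition free_from (t0 : R) (u : R -> R -> R[i]) : R -> R -> R[i] :=
  fun t => exp_it_Delta (t - t0) (u t0).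

Definition unexceptional (eta0 tm tp : R) (u : R -> R -> R[i]) (I : set R) : Prop :=
  (L10_norm I (free_from tp u) <= (eta0 ^+ 10)%:E)%E /\
  (L10_norm I (free_from tm u) <= (eta0 ^+ 10)%:E)%E.

End Radial.

(* Main.v *)
Require Import Defs.
From HB Require Import structures.
From mathcomp Require Import all_boot all_order all_algebra.
From mathcomp Require Import all_classical all_reals all_analysis.
From mathcomp Require Import complex.
From mathcomp Require Import measurable_realfun ring lra.

Set Implicit Arguments.
Unset Strict Implicit.
Unset Printing Implicit Defensive.

Import Order.TTheory GRing.Theory Num.Theory.
Import numFieldNormedType.Exports.

Local Open Scope classical_set_scope.
Local Open Scope ring_scope.

(** In the exterior of the unit ball a radial function of finite energy is
    bounded.  As f(1) = 0, for every r >= 1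
      |f(r)| <= int_1^r |f'| ds <= int_1^r (s^2 |f'|^2 + s^-2) ds,
    where the first part is controlled by the energy and the second one is at
    most 1; the origin, where radial profiles may concentrate, has been removed
    ([radial_sobolev]).  Hence, with M a bound on |u| depending on E only,
      int_Omega |u(t)|^10 <= M^4 int_Omega |u(t)|^6 <= 6 E M^4
    at each time ([integral_Omega_L10_le]), and the tenth power of the L^10
    norm of u on I x Omega is at most 6 E M^4 |I| ([L10_norm_le]).  If that norm
    exceeds eta0, then |I| > eta0^10 / (6 E M^4), so that any eta1 below this
    quotient is a lower bound for |I|.

    The analytic content is the inequality |f(r)| <= int_1^r |f'| for a function
    that is absolutely continuous in the epsilon-delta sense, with [derive1] as
    derivative: this needs differentiability almost everywhere as well as the
    fundamental theorem of calculus ([abs_continuous_ftc]).  An absolutely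
    continuous function is a difference of two nondecreasing ones, which are
    absolutely continuous too ([abs_continuous_jordan]); the Stieltjes measure
    of each of these vanishes on Lebesgue null sets
    ([abs_continuous_stieltjes_null]) and has a Radon-Nikodym density, and by
    Lebesgue differentiation the difference of the densities is the derivative
    almost everywhere. *)

(** * Absolute continuity and total variation *)

Section AbsolutelyContinuous.
Context {R : realType}.
Implicit Types (f g : R -> R) (phi : R -> R).

(** Families of intervals are indexed by arbitrary finite types, so that
    subdividing each interval of a family gives a family indexed by a sigma
    type.  The condition is on the whole line: a function given on [a, b] is
    first extended by constants, composing it with [clamp a b]. *)
Definition abs_continuous f : Prop :=
  forall e : R, 0 < e -> exists2 d : R, 0 < d &
  forall (K : finType) (x y : K -> R), (forall k, x k <= y k) ->
    trivIset setT (fun k => `]x k, y k[%classic) ->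
    \sum_k (y k - x k) < d -> \sum_k `|f (y k) - f (x k)| < e.

(** A common point of the images of two intervals forces x i < y j and
    x j < y i, hence the intervals themselves overlap. *)
Lemma trivIset_homo (K : Type) phi (x y : K -> R) :
  {homo phi : s t / s <= t} ->
  trivIset setT (fun k => `]x k, y k[%classic) ->
  trivIset setT (fun k => `]phi (x k), phi (y k)[%classic).
Proof.
move=> phi_homo disj i j _ _ [z [/=]].
rewrite !in_itv/= => /andP[xiz zyi] /andP[xjz zyj].
have lt s t : phi s < z -> z < phi t -> s < t.
  move=> sz zt; rewrite ltNge; apply/negP => /phi_homo.
  by rewrite leNgt (lt_trans sz zt).
have [ii ij ji jj] := And4 (lt _ _ xiz zyi) (lt _ _ xiz zyj)
  (lt _ _ xjz zyi) (lt _ _ xjz zyj).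
apply: disj => //; exists ((Num.max (x i) (x j) + Num.min (y i) (y j)) / 2).
have m : Num.max (x i) (x j) < Num.min (y i) (y j).
  by rewrite gt_max !lt_min ii ij ji jj.
split; rewrite /= in_itv/=; apply/andP; split.
- by rewrite (le_lt_trans _ (midf_lt m).1)// le_max lexx.
- by rewrite (lt_le_trans (midf_lt m).2)// ge_min lexx.
- by rewrite (le_lt_trans _ (midf_lt m).1)// le_max lexx orbT.
- by rewrite (lt_le_trans (midf_lt m).2)// ge_min lexx orbT.
Qed.

Lemma abs_continuous_comp f phi : {homo phi : s t / s <= t} ->
  (forall s t, s <= t -> phi t - phi s <= t - s) ->
  abs_continuous f -> abs_continuous (f \o phi).
Proof.
move=> phi_homo phi_lip acf e e0; have [d d0 H] := acf e e0.
exists d => // K x y xy disj lt; apply: (H K (phi \o x) (phi \o y)).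
- by move=> k; exact: phi_homo.
- exact: trivIset_homo.
- by apply: le_lt_trans lt; apply: ler_sum => k _; exact: phi_lip.
Qed.

Lemma abs_continuous_sub f g :
  abs_continuous f -> abs_continuous g -> abs_continuous (f \- g).
Proof.
move=> acf acg e e0; have e20 : 0 < e / 2 by rewrite divr_gt0.
have [df df0 Hf] := acf _ e20; have [dg dg0 Hg] := acg _ e20.
exists (Num.min df dg); first by rewrite lt_min df0.
move=> K x y xy disj; rewrite lt_min => /andP[ltf ltg].
rewrite [ltRHS]splitr (le_lt_trans _ (ltrD (Hf _ _ _ xy disj ltf)
  (Hg _ _ _ xy disj ltg)))// -big_split/=.
apply: ler_sum => k _; rewrite -[in X in _ <= _ + X]normrN.
rewrite [X in `|X| <= _](_ : _ = f (y k) - f (x k) - (g (y k) - g (x k))).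
  exact: ler_normD.
by rewrite /=; ring.
Qed.

Lemma trivIset_consecutive (p : nat -> R) :
  {homo p : i j / (i <= j)%N >-> i <= j} ->
  trivIset setT (fun i => `]p i, p i.+1[%classic).
Proof.
move=> p_homo i j _ _ [z [/=]]; rewrite !in_itv/= => /andP[iz zi] /andP[jz zj].
apply/eqP; rewrite eqn_leq; apply/andP; split; rewrite leqNgt; apply/negP.
- by move=> /p_homo; rewrite leNgt (lt_trans iz zj).
- by move=> /p_homo; rewrite leNgt (lt_trans jz zi).
Qed.

(** With b as default value, the points of a partition of [a, b] extend to a
    nondecreasing sequence that is constant past the end of the partition. *)
Lemma itv_partition_nth_homo a b (s : seq R) : itv_partition a b s ->
  {homo nth b (a :: s) : i j / (i <= j)%N >-> i <= j}.
Proof.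
move=> abs; apply/nondecreasing_seqP => i.
have [ilt|sle] := ltnP i (size s).
  by apply: (nondecreasing_fun_itv_partition (f := id) _ abs).
rewrite [leRHS]nth_default//; move: sle; rewrite leq_eqVlt => /predU1P[<-|lt].
  by rewrite -last_nth; case: abs => _ /eqP ->.
by rewrite nth_default.
Qed.

Lemma variationE a b f s : variation a b f s =
  \sum_(i < size s) `|f (nth b (a :: s) i.+1) - f (nth b (a :: s) i)|.
Proof. by rewrite /variation big_mkord. Qed.

Lemma itv_partition_length a b (s : seq R) : itv_partition a b s ->
  \sum_(i < size s) (nth b (a :: s) i.+1 - nth b (a :: s) i) = b - a.
Proof.
move=> abs.
rewrite -(big_mkord xpredT (fun i => nth b (a :: s) i.+1 - nth b (a :: s) i)).
by rewrite telescope_sumr// -last_nth; case: abs => _ /eqP ->.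
Qed.

(** Intervals shorter than the modulus d for e = 1 carry variation at most 1,
    and [a, b] is covered by finitely many steps of length d / 2. *)
Lemma abs_continuous_total_variation_fin f a b : abs_continuous f -> a <= b ->
  total_variation a b f \is a fin_num.
Proof.
move=> acf; have [d d0 H] := acf 1 ltr01.
have small x y : x <= y -> y - x < d -> (total_variation x y f <= 1)%E.
  move=> xy yxd; apply: ge_ereal_sup => _ [v [s xys <-] <-].
  rewrite lee_fin ltW// variationE; have p_homo := itv_partition_nth_homo xys.
  apply: (H _ (fun i : 'I__ => nth y (x :: s) i)
    (fun i : 'I__ => nth y (x :: s) i.+1)).
  - by move=> k; exact: p_homo.
  - move=> i j _ _ /(trivIset_consecutive p_homo)-/(_ I I) ij.
    exact: val_inj.
  - by rewrite itv_partition_length.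
have bounded n : forall x y, x <= y -> y - x <= n%:R * (d / 2) ->
    (total_variation x y f <= n%:R%:E)%E.
  elim: n => [|n IH] x y xy.
    rewrite mul0r => yx; have -> : x = y by lra.
    by rewrite total_variationxx.
  move=> yx; pose c := Num.max x (y - d / 2).
  have xc : x <= c by rewrite le_max lexx.
  have cy : c <= y by rewrite ge_max xy/=; lra.
  rewrite (total_variationD f xc cy) -(@natr1 _ n) EFinD leeD//.
    have n0 : 0 <= n%:R * (d / 2) by rewrite mulr_ge0// divr_ge0// ltW.
    apply: IH => //; rewrite lerBlDr ge_max lerDr n0/=.
    by move: yx; rewrite -(@natr1 _ n); lra.
  apply: small => //; have : y - d / 2 <= c by rewrite le_max lexx orbT.
  by lra.
move=> ab; rewrite ge0_fin_numE ?total_variation_ge0//.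
pose n := Num.bound ((b - a) / (d / 2)).
apply: le_lt_trans (bounded n a b ab _) (ltry _).
rewrite -ler_pdivrMr ?divr_gt0//; apply: ltW; apply: archi_boundP.
by rewrite divr_ge0 ?subr_ge0//; lra.
Qed.

Lemma variation_near f x y (eta : R) : 0 < eta -> x <= y ->
  total_variation x y f \is a fin_num ->
  exists2 s, itv_partition x y s &
    fine (total_variation x y f) <= variation x y f s + eta.
Proof.
move=> eta0 xy fin.
have [_ [v [s xys <-] <-] lt] := ub_ereal_sup_adherent eta0 fin.
exists s => //; rewrite -lee_fin fineK//.
by rewrite EFinD -leeBlDr// ltW.
Qed.

(** The modulus of f is also one for its total variation: replacing each
    interval by a partition that nearly realises its total variation yields
    another disjoint family, with the same total length. *)
Lemma abs_continuous_total_variation_sum f (e : R) :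
  abs_continuous f -> 0 < e -> exists2 d : R, 0 < d &
  forall (K : finType) (x y : K -> R), (forall k, x k <= y k) ->
    trivIset setT (fun k => `]x k, y k[%classic) ->
    \sum_k (y k - x k) < d ->
    \sum_k fine (total_variation (x k) (y k) f) < e.
Proof.
move=> acf e0; have e20 : 0 < e / 2 by rewrite divr_gt0.
have [d d0 H] := acf _ e20; exists d => // K x y xy disj lt.
(* the loss allowed in each of the #|K| intervals *)
pose eta := e / 2 / #|K|.+1%:R.
have eta0 : 0 < eta by rewrite divr_gt0.
have /all_sig2[s xys sE] : forall k, {s | itv_partition (x k) (y k) s &
    fine (total_variation (x k) (y k) f) <= variation (x k) (y k) f s + eta}.
  move=> k; apply: cid2; apply: variation_near => //.
  exact: abs_continuous_total_variation_fin.
pose p k := nth (y k) (x k :: s k).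
have p_homo k := itv_partition_nth_homo (xys k).
have p_in k i z : (i < size (s k))%N -> `]p k i, p k i.+1[%classic z ->
    `]x k, y k[%classic z.
  move=> ilt; rewrite /= !in_itv/= => /andP[iz zi]; apply/andP; split.
    by apply: le_lt_trans iz; exact: (p_homo k 0%N i).
  apply: (lt_le_trans zi); have := p_homo k i.+1 (size (s k)) ilt.
  by rewrite -[in X in _ <= X]last_nth; case: (xys k) => _ /eqP ->.
have small : \sum_k variation (x k) (y k) f (s k) < e / 2.
  pose S : finType := {k : K & 'I_(size (s k))}.
  have := H S (fun u => p (tag u) (tagged u))
    (fun u => p (tag u) (tagged u).+1).
  rewrite -(@sig_big_dep _ _ _ K (fun k => 'I_(size (s k)))
     xpredT (fun _ _ => true) (fun k i => `|f (p k i.+1) - f (p k i)|))/=.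
  rewrite -(@sig_big_dep _ _ _ K (fun k => 'I_(size (s k)))
     xpredT (fun _ _ => true) (fun k i => p k i.+1 - p k i))/=.
  under [in X in _ -> _ -> _ -> X]eq_bigr do rewrite -variationE.
  apply => //.
  - by move=> u; exact: p_homo.
  - move=> [k i] [l j] _ _ /= [z [zi zj]].
    have kl : k = l.
      by apply: disj => //; exists z; split; [exact: p_in zi|exact: p_in zj].
    subst l; congr (existT _ _ _); apply: val_inj.
    by apply: (trivIset_consecutive (p_homo k)) => //; exists z.
  - by under eq_bigr do rewrite itv_partition_length//.
apply: (@le_lt_trans _ _ (\sum_k (variation (x k) (y k) f (s k) + eta))).
  by apply: ler_sum => k _; exact: sE.
rewrite big_split/= sumr_const [ltRHS]splitr ltr_leD//.
rewrite -[leLHS]mulr_natl /eta mulrCA; apply: ler_piMr; first exact: ltW.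
by rewrite ler_pdivrMr// mul1r ler_nat.
Qed.

(** Jordan decomposition: F(x) is the total variation of f on [a, x] and
    G = F - f, both made constant to the left of a. *)
Lemma abs_continuous_jordan f a : abs_continuous f -> exists F G : R -> R,
  [/\ {homo F : x y / x <= y}, {homo G : x y / x <= y},
      abs_continuous F, abs_continuous G &
      forall x, a <= x -> f x = F x - G x].
Proof.
move=> acf; pose phi x := Num.max a x.
pose F x := fine (total_variation a (phi x) f).
have phi_homo : {homo phi : x y / x <= y}.
  by move=> x y xy; rewrite /phi ge_max !le_max lexx xy orbT.
have phi_lip x y : x <= y -> phi y - phi x <= y - x.
  rewrite /phi; case: (leP a x); case: (leP a y) => //; lra.
have aphi x : a <= phi x by rewrite le_max lexx.
have FE x y : x <= y -> F y - F x = fine (total_variation (phi x) (phi y) f).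
  move=> /phi_homo xy; rewrite /F (total_variationD f (aphi x) xy).
  by rewrite fineD ?abs_continuous_total_variation_fin// addrAC subrr add0r.
have F_homo : {homo F : x y / x <= y}.
  move=> x y xy; rewrite -subr_ge0 FE// fine_ge0//.
  by rewrite total_variation_ge0// phi_homo.
have acF : abs_continuous F.
  move=> e e0; have [d d0 H] := abs_continuous_total_variation_sum acf e0.
  exists d => // K x y xy disj lt.
  apply: (@le_lt_trans _ _
      (\sum_k fine (total_variation (phi (x k)) (phi (y k)) f))).
    apply: ler_sum => k _; rewrite FE// ger0_norm// fine_ge0//.
    by rewrite total_variation_ge0// phi_homo.
  apply: H; first by move=> k; exact: phi_homo.
    exact: trivIset_homo.
  by apply: le_lt_trans lt; apply: ler_sum => k _; exact: phi_lip.
exists F, (F \- (f \o phi)); split => //.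
- move=> x y xy /=; have := @total_variation_ge _ _ _ f (phi_homo _ _ xy).
  rewrite -[leRHS]fineK ?abs_continuous_total_variation_fin ?phi_homo//.
  rewrite lee_fin -FE//.
  by move=> /ler_normlW; lra.
- by apply: abs_continuous_sub => //; exact: abs_continuous_comp.
- by move=> x ax /=; rewrite /phi (max_idPr ax); ring.
Qed.

Lemma abs_continuous_continuous f : abs_continuous f -> continuous f.
Proof.
move=> acf x; apply/cvgrPdist_lt => e e0; have [d d0 H] := acf e e0.
have close s t : s <= t -> t - s < d -> `|f t - f s| < e.
  move=> st tsd; have := H 'I_1 (fun=> s) (fun=> t).
  by rewrite !big_ord1; apply => // -[[]]// ? [[]]// ? _ _ _; exact: val_inj.
near=> y; have xyd : `|x - y| < d.
  by near: y; apply: cvgr_dist_lt; [exact: cvg_id|].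
have [xy|/ltW yx] := leP x y.
  by rewrite distrC close//; rewrite distrC ger0_norm ?subr_ge0// in xyd.
by rewrite close//; rewrite ger0_norm ?subr_ge0// in xyd.
Unshelve. all: by end_near. Qed.

End AbsolutelyContinuous.

(** * The fundamental theorem of calculus *)

Section Density.
Context {R : realType}.
Local Notation mu := (@lebesgue_measure R).

Lemma open_bounded_disjoint_itv (U : set R) (a b : R) : open U ->
  U `<=` `[a, b]%classic -> exists x y : nat -> R,
  [/\ forall n, x n <= y n,
      trivIset setT (fun n => `]x n, y n[%classic) &
      U = \bigcup_n `]x n, y n[%classic].
Proof.
move=> oU Uab; pose I := open_disjoint_itv oU.
have sub n : I n `<=` U.
  by move=> z Iz; rewrite (open_disjoint_itv_bigcup oU); exists n.
have /all_sig2[xy xy_le IE] : forall n, {p : R * R | p.1 <= p.2 &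
    I n = `]p.1, p.2[%classic}.
  move=> n; apply: cid2; case: (pselect (I n = set0)) => [I0|/eqP/set0P I0].
    exists (a, a) => //=.
    by rewrite I0 set_itv_ge// bnd_simp ltxx.
  have ub : has_ubound (I n).
    by exists b => z /sub/Uab/=; rewrite in_itv/= => /andP[].
  have lb : has_lbound (I n).
    by exists a => z /sub/Uab/=; rewrite in_itv/= => /andP[].
  exists (inf (I n), sup (I n)) => /=.
    by case: I0 => z Iz; rewrite (le_trans (inf_lbound lb Iz))// ub_le_sup.
  rewrite -(interval_bounded_interior _ lb ub); last first.
    exact: open_disjoint_itv_is_interval.
  apply/esym/interior_id; exact: open_disjoint_itv_open.
exists (fst \o xy), (snd \o xy); split => //=.
  by under eq_fun do rewrite -IE; exact: open_disjoint_itv_trivIset.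
rewrite [LHS](open_disjoint_itv_bigcup oU).
by apply: eq_bigcupr => n _; rewrite -IE.
Qed.

Lemma lebesgue_stieltjes_itv_oc (F : cumulative R R) (x y : R) : x <= y ->
  (lebesgue_stieltjes_measure F `]x, y]%classic = (F y - F x)%:E)%E.
Proof.
move=> xy; rewrite -(wlength_itv_bnd F false false xy).
rewrite /lebesgue_stieltjes_measure /measure_extension measurable_mu_extE//.
exact: is_ocitv.
Qed.

(** By outer regularity N lies in an open set of Lebesgue measure below the
    modulus of F for e.  The components of this set are disjoint intervals, and
    the increments of F over any finitely many of them sum to less than e. *)
Lemma abs_continuous_stieltjes_null (F : cumulative R R) (a b : R)
    (N : set R) : abs_continuous F ->
  measurable N -> mu N = 0%E -> N `<=` `]a, b]%classic ->
  lebesgue_stieltjes_measure F N = 0%E.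
Proof.
move=> acF mN N0 Nab; apply/eqP; rewrite eq_le measure_ge0 andbT.
apply/lee_addgt0Pr => e e0; rewrite add0e; have [d d0 H] := acF e e0.
have Nfin : (mu N < +oo)%E by rewrite N0.
have [U [oU NU UNd]] := lebesgue_regularity_outer mN Nfin d0.
(* cutting down to a bounded set makes all components bounded *)
pose V := U `&` `]a, (b + 1)[%classic.
have oV : open V by apply: openI => //; exact: interval_open.
have NV : N `<=` V.
  move=> z Nz; split; first exact: NU.
  by have /= := Nab _ Nz; rewrite !in_itv/= => /andP[-> zb]/=; lra.
have mV : measurable V by exact: open_measurable.
have Vd : (mu V < d%:E)%E.
  apply: le_lt_trans UNd; apply: (@le_trans _ _ (mu (V `\` N `|` N))).
    apply: le_measure; rewrite ?inE//.
      by apply: measurableU => //; exact: measurableD.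
    by rewrite setDKU.
  apply: le_trans (measureU2 _ _ _) _ => //; first exact: measurableD.
  rewrite [X in (_ + X <= _)%E]N0 adde0; apply: le_measure; rewrite ?inE.
  - exact: measurableD.
  - by apply: measurableD => //; exact: open_measurable.
  - by apply: setSD; exact: subIsetl.
have Vab : V `<=` `[a, (b + 1)]%classic.
  by move=> z [_]; exact: subset_itv_oo_cc.
have [x [y [xy disj VE]]] := open_bounded_disjoint_itv oV Vab.
have mI n : measurable `]x n, y n[%classic by exact: measurable_itv.
apply: (@le_trans _ _ (lebesgue_stieltjes_measure F V)).
  by apply: le_measure; rewrite ?inE.
have VsumE (m : {measure set (measurableTypeR R) -> \bar R}) :
    m V = (\sum_(0 <= i <oo) m `]x i, y i[%classic)%E.
  rewrite VE measure_bigcup//; apply: eq_eseriesl => i; exact: in_setT.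
rewrite VsumE; apply: lime_le.
  by apply: is_cvg_nneseries => n _ _; exact: measure_ge0.
apply: nearW => n.
apply: (@le_trans _ _ (\sum_(0 <= i < n) (F (y i) - F (x i))%:E)%E).
  apply: lee_sum => i _; rewrite -lebesgue_stieltjes_itv_oc//.
  apply: le_measure; rewrite ?inE; [exact: mI|exact: measurable_itv|].
  exact: subset_itv_oo_oc.
rewrite big_mkord sumEFin lee_fin ltW//.
apply: le_lt_trans (H 'I_n (x \o val) (y \o val) _ _ _) => /=.
- by apply: ler_sum => i _; exact: ler_norm.
- by move=> i; exact: xy.
- by move=> i j _ _ ij; apply: val_inj; exact: disj.
rewrite -lte_fin; apply: le_lt_trans Vd.
rewrite VsumE -sumEFin.
rewrite -(big_mkord xpredT (fun i => (y i - x i)%:E)).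
apply: le_trans (nneseries_lim_ge n _); last first.
  by move=> i _ _; exact: measure_ge0.
apply: lee_sum => i _.
rewrite [leRHS](lebesgue_measure_itv `]x i, y i[)/= lte_fin.
by case: ltP => // yx; rewrite lee_fin subr_le0.
Qed.

Lemma abs_continuous_nondecreasing_density (F : R -> R) (a b : R) : a <= b ->
  {homo F : x y / x <= y} -> abs_continuous F ->
  exists g : R -> R, [/\ mu.-integrable [set: R] (EFin \o g) &
    forall x, a <= x <= b -> F x - F a = \int[mu]_(t in `]a, x]) g t].
Proof.
move=> ab F_homo acF.
have F_rc : right_continuous F.
  by apply: right_continuousW; exact: abs_continuous_continuous.
pose C := isCumulative.Build R _ R F F_homo F_rc.
pose F' : cumulative R R := HB.pack F C.
have mD : measurable (`]a, b]%classic : set (measurableTypeR R)).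
  exact: measurable_itv.
have finD : (lebesgue_stieltjes_measure F' `]a, b]%classic < +oo)%E.
  by rewrite lebesgue_stieltjes_itv_oc// ltry.
(* the Radon-Nikodym theorem applies to finite measures *)
pose nu := mfrestr mD finD.
have nu_mu : nu `<< mu.
  apply/null_content_dominatesP => A mA A0.
  apply: (@abs_continuous_stieltjes_null F' a b).
  - exact: acF.
  - exact: measurableI.
  - apply/eqP; rewrite eq_le measure_ge0 andbT -A0 le_measure ?inE//.
      exact: measurableI.
  - exact: subIsetr.
have [g [g0 gfin gint nuE]] := radon_nikodym_sigma_finite nu_mu.
exists (fine \o g); split.
  by apply: eq_integrable gint => // x _; rewrite /= fineK.
move=> x /andP[ax xb].
have sub : `]a, x]%classic `<=` `]a, b]%classic.
  by move=> z /=; rewrite !in_itv/= => /andP[-> zx]/=; exact: le_trans xb.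
have nuax : nu `]a, x]%classic = (F x - F a)%:E.
  rewrite -(lebesgue_stieltjes_itv_oc F' ax).
  by rewrite /nu /mfrestr /mrestr/= (setIidl sub).
rewrite /Rintegral; under eq_integral do rewrite /= fineK//.
have /= := etrans (esym nuax) (nuE _ (measurable_itv _)) => <-.
by [].
Qed.

Lemma abs_continuous_density (f : R -> R) (a b : R) :
  a <= b -> abs_continuous f ->
  exists g : R -> R, mu.-integrable [set: R] (EFin \o g) /\
    forall x, a <= x <= b -> f x - f a = \int[mu]_(t in `]a, x]) g t.
Proof.
move=> ab acf.
have [F [G [F_homo G_homo acF acG fE]]] := abs_continuous_jordan a acf.
have [g [gint gE]] := abs_continuous_nondecreasing_density ab F_homo acF.
have [h [hint hE]] := abs_continuous_nondecreasing_density ab G_homo acG.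
exists (g \- h); split; first exact: (integrableB measurableT gint hint).
move=> x axb; have /andP[ax xb] := axb.
rewrite RintegralB//; last 2 first.
- exact: integrableS gint.
- exact: integrableS hint.
by rewrite -gE// -hE// !fE//; ring.
Qed.

(** Near x in ]a, b[ the function f is f(a) plus the indefinite integral of the
    density, whose derivative is the density at almost every x. *)
Lemma abs_continuous_ftc (f : R -> R) (a b : R) : a <= b -> abs_continuous f ->
  exists g : R -> R, [/\ mu.-integrable [set: R] (EFin \o g),
    forall x, a <= x <= b -> f x - f a = \int[mu]_(t in `]a, x]) g t &
    {ae mu, forall x, a < x < b -> derive1 f x = g x}].
Proof.
move=> ab acf; have [g [gint gE]] := abs_continuous_density ab acf.
exists g; split => //.
have gloc : locally_integrable setT g.
  by apply: open_integrable_locally => //; exact: openT.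
have gitv y : mu.-integrable [set` Interval (BRight a) (BRight y)] (EFin \o g).
  exact: integrableS gint.
have := FTC1 gitv gloc.
apply: filterS; first exact: (ae_filter_ringOfSetsType mu).
move=> x /= H /andP[ax xb].
have [|dF <-] := H; first by rewrite lte_fin.
rewrite !derive1E; set F := fun _ => _ in dF *.
have -> : 'D_1 f x = 'D_1 (cst (f a) + F) x.
  apply: near_eq_derive; near=> y.
  have yab : a <= y <= b.
    apply/andP; split; apply/ltW; near: y; [exact: lt_nbhsr|exact: lt_nbhsl].
  have E : f y - f a = F y := gE y yab.
  by rewrite -[RHS]/(f a + F y) -E; ring.
by rewrite deriveD// derive_cst add0r.
Unshelve. all: by end_near. Qed.

End Density.

(** * Integrals of functions of unknown measurability *)

Section LowerIntegral.
Context d (T : measurableType d) {R : realType}.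
Variable mu : {measure set T -> \bar R}.
Implicit Types (A D : set T) (f g : T -> \bar R).

Import HBNNSimple.

(** The integral of a nonnegative function is a supremum over the simple
    functions below it, hence monotone whether or not the function is
    measurable.  This is what allows comparisons with integrands built from
    [derive1], or with functions of time that are not known to be measurable. *)
Lemma lower_integral_le A D f g : A `<=` D ->
  (forall x, A x -> 0 <= g x)%E -> (forall x, D x -> 0 <= f x)%E ->
  (forall x, A x -> g x <= f x)%E ->
  (\int[mu]_(x in A) g x <= \int[mu]_(x in D) f x)%E.
Proof.
move=> AD g0 f0 gf; rewrite !ge0_integralE//.
apply: ge_ereal_sup => _ [h hg <-]; apply: ereal_sup_ubound; exists h => //= x.
apply: le_trans (hg x) _; rewrite !patchE.
case: ifPn => [/set_mem Ax|_]; first by rewrite mem_set ?gf//; exact: AD.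
by case: ifPn => // /set_mem; exact: f0.
Qed.

(** Dividing by k a simple function below k f gives one below f. *)
Lemma lower_integralZl D f (k : R) : 0 < k -> (forall x, D x -> 0 <= f x)%E ->
  (\int[mu]_(x in D) (k%:E * f x) <= k%:E * \int[mu]_(x in D) f x)%E.
Proof.
move=> k0 f0; have ki0 : 0 <= k^-1 by rewrite invr_ge0 ltW.
rewrite !ge0_integralE//; last first.
  by move=> x Dx; rewrite mule_ge0 ?f0// lee_fin ltW.
apply: ge_ereal_sup => _ [h hf <-]; rewrite -lee_pdivrMl//.
rewrite -sintegralrM; apply: ereal_sup_ubound.
exists (scale_nnsfun h ki0) => //= x.
rewrite EFinM lee_pdivrMl// (le_trans (hf x))// !patchE.
by case: ifP => //; rewrite mule0.
Qed.

End LowerIntegral.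

(** * Pointwise bound for radial functions of finite energy *)

Section RadialSobolev.
Context {R : realType}.
Local Notation mu := (@lebesgue_measure R).

Lemma measurable_sqrV (b : R) : measurable_fun `]1, b] (fun r : R => r ^- 2).
Proof.
apply: (@measurable_funS _ _ _ _ `[1, b]) => //; first exact: subset_itv_oc_cc.
apply: subspace_continuous_measurable_fun => //.
apply: continuous_in_subspaceT => x; rewrite inE/= in_itv/= => /andP[x1 _].
apply: (@continuousV R R (fun r => r ^+ 2)).
  by rewrite expf_neq0// gt_eqF// (lt_le_trans _ x1).
exact: exprn_continuous.
Qed.

Lemma integral_sqrV (b : R) : 1 < b ->
  (\int[mu]_(r in `]1%R, b]) (r ^- 2)%:E <= 1)%E.
Proof.
move=> b1; have pos x : `[1, b]%classic x -> x != 0.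
  by rewrite /= in_itv/= => /andP[x1 _]; rewrite gt_eqF// (lt_le_trans _ x1).
have cont x : x != 0 -> {for x, continuous (fun r : R => - r^-1)}.
  by move=> x0; apply: continuousN; exact: inv_continuous.
have der x : x != 0 -> is_derive x (1 : R) (fun r : R => - r^-1) (x ^- 2).
  move=> x0; have := is_deriveN (is_deriveV x0 (is_derive_id x (1 : R))).
  by rewrite scaleNr opprK /GRing.scale/= mulr1.
rewrite integral_itv_obnd_cbnd; last first.
  by apply/measurable_EFinP; exact: measurable_sqrV.
rewrite (@continuous_FTC2 R (fun r => r ^- 2) (fun r => - r^-1) 1 b)//.
- have bi0 : 0 <= b^-1 by rewrite invr_ge0 ltW// (lt_trans _ b1).
  by rewrite -EFinB lee_fin invr1 opprK; lra.
- apply: continuous_in_subspaceT => x /[1!inE] /pos x0.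
  apply: (@continuousV R R (fun r => r ^+ 2)); first by rewrite expf_neq0.
  exact: exprn_continuous.
- split.
  + move=> x /subset_itv_oo_cc/pos x0; by have [] := der x x0.
  + by apply: cvg_at_right_filter; apply: cont; rewrite oner_neq0.
  + by apply: cvg_at_left_filter; apply: cont; rewrite gt_eqF// (lt_trans _ b1).
- move=> x /subset_itv_oo_cc/pos x0; rewrite derive1E.
  by have [] := der x x0.
Qed.

Definition clamp (a b x : R) : R := Num.max a (Num.min b x).

Lemma clamp_homo a b : {homo clamp a b : x y / x <= y}.
Proof.
move=> x y xy; rewrite /clamp ge_max !le_max lexx/=.
by rewrite le_min !ge_min lexx xy !orbT.
Qed.

Lemma clamp_lip a b x y : x <= y -> clamp a b y - clamp a b x <= y - x.
Proof.
by rewrite /clamp; case: (leP b x); case: (leP b y); case: (leP a b);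
  case: (leP a x); case: (leP a y); lra.
Qed.

Lemma clamp_ge a b x : a <= clamp a b x.
Proof. by rewrite le_max lexx. Qed.

Lemma clamp_le a b x : a <= b -> clamp a b x <= b.
Proof. by move=> ab; rewrite ge_max ab ge_min lexx. Qed.

Lemma clamp_id a b x : a <= x <= b -> clamp a b x = x.
Proof. by move=> /andP[ax xb]; rewrite /clamp (min_idPr xb) (max_idPr ax). Qed.

(** Stated for a 1-Lipschitz p in order to cover real and imaginary parts. *)
Lemma abs_cont_clamp (p : R[i] -> R) (a b : R) (f : R -> R[i]) : a <= b ->
  (forall z w, `|p z - p w| <= cnorm (z - w)) ->
  abs_cont a b f -> abs_continuous (p \o f \o clamp a b).
Proof.
move=> ab p_lip acf e e0; have [d d0 H] := acf e e0.
exists d => // K x y xy disj lt.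
pose c (z : K -> R) (i : 'I_#|K|) := clamp a b (z (enum_val i)).
have sum_enum (F : K -> R) : \sum_k F k = \sum_(i < #|K|) F (enum_val i).
  by rewrite -big_enum_val; apply: eq_bigl.
rewrite sum_enum; apply: le_lt_trans (H _ (c x) (c y) _ _ _).
- by apply: ler_sum => i _; exact: p_lip.
- move=> i; split; first exact: clamp_ge.
  by split; [exact: clamp_homo|exact: clamp_le].
- apply: (trivIset_homo (@clamp_homo a b)) => i j _ _ ij.
  by apply: enum_val_inj; apply: disj.
- rewrite sum_enum in lt; apply: le_lt_trans lt.
  by apply: ler_sum => i _; exact: clamp_lip.
Qed.

Lemma weight_ge0 (r : R) : 0 <= 4 * pi * r ^+ 2.
Proof. by rewrite mulr_ge0 ?sqr_ge0// mulr_ge0// pi_ge0. Qed.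

(** With g the almost everywhere derivative of q, the pointwise inequality
    |g| <= 4 pi r^2 g^2 + r^-2 bounds the integral of |g| by K + 1. *)
Lemma radial_sobolev_real (q k : R -> R) (b K : R) : 1 < b ->
  abs_continuous (q \o clamp 1 b) -> q 1 = 0 ->
  (forall r, derive1 q r ^+ 2 <= k r) ->
  (integral_Omega k <= K%:E)%E -> `|q b| <= K + 1.
Proof.
move=> b1 acq q1 dqk kK.
have [g [gint gE gd]] := abs_continuous_ftc (ltW b1) acq.
have qbE : q b = \int[mu]_(t in `]1, b]) g t.
  rewrite -gE ?lexx ?(ltW b1)//= !clamp_id ?lexx ?(ltW b1)//.
  by rewrite q1 subr0.
have gi : mu.-integrable `]1, b] (EFin \o g) by exact: integrableS gint.
have mg : measurable_fun `]1, b] g.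
  by apply/measurable_EFinP; exact: measurable_int gi.
pose w r := 4 * pi * r ^+ 2 * g r ^+ 2.
have w0 r : 0 <= w r by rewrite mulr_ge0 ?weight_ge0 ?sqr_ge0.
have mw : measurable_fun `]1, b] w.
  apply: measurable_funM; last exact: measurable_funX.
  apply: measurable_funM => //; apply: measurable_funX; exact: measurable_id.
(* g is the derivative of q outside N and off the right endpoint, where the
   clamped function may have a corner *)
have wK : (\int[mu]_(r in `]1%R, b]) (w r)%:E <= K%:E)%E.
  have [N [mN N0 subN]] := gd.
  have mNb : measurable (N `|` [set b]) by apply: measurableU.
  rewrite (@ge0_negligible_integral _ _ _ _ _ (N `|` [set b]))//; first last.
  - rewrite measureU0//. exact: lebesgue_measure_set1.
  - by move=> x _; rewrite lee_fin.
  - exact/measurable_EFinP.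
  apply: le_trans kK; apply: lower_integral_le.
  - move=> r [/=]; rewrite !in_itv/= => /andP[r1 _] _.
    by rewrite /radii/= in_itv/= andbT ltW.
  - by move=> r _; rewrite lee_fin.
  - move=> r _; rewrite lee_fin mulr_ge0 ?weight_ge0//.
    exact: le_trans (sqr_ge0 _) (dqk r).
  move=> r [/=]; rewrite in_itv/= => /andP[r1 rb] /not_orP[Nr rneb].
  have rb' : 1 < r < b by rewrite r1 lt_neqAle rb andbT; apply/eqP.
  have : derive1 (q \o clamp 1 b) r = g r.
    by apply: contrapT => H; apply: Nr; apply: subN => /(_ rb').
  move=> gr; rewrite lee_fin /w ler_wpM2l ?weight_ge0//.
  rewrite -gr (_ : derive1 _ r = derive1 q r)// !derive1E.
  apply: near_eq_derive; near=> x; rewrite /= clamp_id//.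
  apply/andP; split; apply/ltW; near: x.
    by apply: lt_nbhsr; case/andP: rb'.
  by apply: lt_nbhsl; case/andP: rb'.
have pi41 : (1 : R) <= 4 * pi by have := pi_ge2 R; lra.
have gw r : r != 0 -> `|g r| <= w r + r ^- 2.
  move=> r0; have a0 : 0 < r ^+ 2 by rewrite exprn_even_gt0.
  rewrite /w; set a := r ^+ 2 in a0 *; rewrite -(real_normK (num_real (g r))).
  set x := `|g r|; have x0 : 0 <= x by exact: normr_ge0.
  have aV : 0 < a^-1 by rewrite invr_gt0.
  have h : a * x ^+ 2 <= 4 * pi * a * x ^+ 2.
    rewrite ler_wpM2r ?sqr_ge0//.
    by rewrite ler_peMl// ltW.
  apply: (@le_trans _ _ (a * x ^+ 2 + a^-1)); last by rewrite lerD2r.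
  (* arithmetic-geometric mean: 2 x <= a x^2 + a^-1 *)
  have : 0 <= a * (x - a^-1) ^+ 2 by rewrite mulr_ge0 ?sqr_ge0 ?ltW.
  have -> : a * (x - a^-1) ^+ 2 = a * x ^+ 2 - 2 * x + a^-1.
    by field; rewrite gt_eqF.
  by lra.
rewrite -lee_fin qbE; have mI : measurable (`]1, b]%classic : set R) by [].
rewrite (le_trans (_ : _ <= \int[mu]_(r in `]1%R, b]) `|(g r)%:E|)%E)//.
  rewrite /Rintegral -abse_EFin fineK; last exact: integrable_fin_num.
  by apply: le_abse_integral => //; exact/measurable_EFinP.
apply: (@le_trans _ _ (\int[mu]_(r in `]1%R, b]) ((w r)%:E + (r ^- 2)%:E))%E).
  apply: lower_integral_le => //.
  - by move=> r _; rewrite adde_ge0// lee_fin// invr_ge0 sqr_ge0.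
  - move=> r /=; rewrite in_itv/= => /andP[r1 _].
    by rewrite -EFinD lee_fin gw// gt_eqF// (lt_trans _ r1).
rewrite ge0_integralD//.
- by rewrite EFinD leeD//; exact: integral_sqrV.
- by move=> r _; rewrite lee_fin.
- exact/measurable_EFinP.
- by move=> r _; rewrite lee_fin invr_ge0 sqr_ge0.
- by apply/measurable_EFinP; exact: measurable_sqrV.
Unshelve. all: by end_near. Qed.

Lemma cnorm_ge0 (z : R[i]) : 0 <= cnorm z.
Proof. by case: z => x y; exact: sqrtr_ge0. Qed.

Lemma sqr_cnorm (z : R[i]) :
  cnorm z ^+ 2 = complex.Re z ^+ 2 + complex.Im z ^+ 2.
Proof.
by case: z => x y /=; rewrite /cnorm /= sqr_sqrtr// addr_ge0 ?sqr_ge0.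
Qed.

Lemma Re_lip (z w : R[i]) : `|complex.Re z - complex.Re w| <= cnorm (z - w).
Proof.
rewrite -ler_sqr ?nnegrE ?cnorm_ge0// sqr_cnorm real_normK ?num_real//.
by case: z w => [a b] [c e] /=; rewrite lerDl sqr_ge0.
Qed.

Lemma Im_lip (z w : R[i]) : `|complex.Im z - complex.Im w| <= cnorm (z - w).
Proof.
rewrite -ler_sqr ?nnegrE ?cnorm_ge0// sqr_cnorm real_normK ?num_real//.
by case: z w => [a b] [c e] /=; rewrite lerDr sqr_ge0.
Qed.

Lemma cnorm_le (z : R[i]) : cnorm z <= `|complex.Re z| + `|complex.Im z|.
Proof.
rewrite -ler_sqr ?nnegrE ?cnorm_ge0 ?addr_ge0// sqr_cnorm sqrrD.
rewrite !real_normK ?num_real// addrAC lerDl mulrn_wge0// mulr_ge0//.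
Qed.

Lemma radial_sobolev (f : R -> R[i]) (K r : R) : 0 <= K -> loc_abs_cont f ->
  f 1 = 0 ->
  (integral_Omega (fun s => (cnorm (cderive f s) ^+ 2)%R) <= K%:E)%E ->
  1 <= r -> cnorm (f r) <= 2 * (K + 1).
Proof.
move=> K0 acf f1 fK; rewrite le_eqVlt => /predU1P[<-|r1].
  by rewrite f1 /cnorm /= expr0n/= addr0 sqrtr0 mulr_ge0// addr_ge0.
apply: le_trans (cnorm_le _) _; rewrite mulr_natl mulr2n; apply: lerD.
- apply: (radial_sobolev_real (q := fun s => complex.Re (f s)) r1 _ _ _ fK).
  + by apply: abs_cont_clamp (ltW r1) Re_lip (acf _ r1).
  + by rewrite /= f1.
  + by move=> s; rewrite sqr_cnorm/= lerDl sqr_ge0.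
- apply: (radial_sobolev_real (q := fun s => complex.Im (f s)) r1 _ _ _ fK).
  + by apply: abs_cont_clamp (ltW r1) Im_lip (acf _ r1).
  + by rewrite /= f1.
  + by move=> s; rewrite sqr_cnorm/= lerDr sqr_ge0.
Qed.

(** * Energy and the spacetime norm *)

Lemma integral_Omega_ge0 (k : R -> R) : (forall r, 0 <= k r) ->
  (0 <= integral_Omega k)%E.
Proof.
move=> k0; apply: integral_ge0 => r _.
by rewrite lee_fin mulr_ge0 ?weight_ge0.
Qed.

Lemma energy_le (f : R -> R[i]) (E : R) : (energy f <= E%:E)%E ->
  (integral_Omega (fun r => (cnorm (cderive f r) ^+ 2)%R) <= (2 * E)%:E)%E /\
  (integral_Omega (fun r => (cnorm (f r) ^+ 6)%R) <= (6 * E)%:E)%E.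
Proof.
rewrite /energy => h.
have A0 : (0 <= integral_Omega (fun r => (cnorm (cderive f r) ^+ 2)%R))%E.
  by apply: integral_Omega_ge0 => r; rewrite exprn_ge0 ?cnorm_ge0.
have B0 : (0 <= integral_Omega (fun r => (cnorm (f r) ^+ 6)%R))%E.
  by apply: integral_Omega_ge0 => r; rewrite exprn_ge0 ?cnorm_ge0.
split; rewrite EFinM -lee_pdivrMl//; apply: le_trans h.
- by rewrite leeDl// mule_ge0// lee_fin.
- by rewrite leeDr// mule_ge0// lee_fin.
Qed.

(** |f|^10 = |f|^4 |f|^6: the first factor is bounded by the supremum of |f|,
    the second one is controlled by the potential energy. *)
Lemma integral_Omega_L10_le (f : R -> R[i]) (E : R) : 0 <= E ->
  in_dotH10 f -> (energy f <= E%:E)%E ->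
  (integral_Omega (fun r => (cnorm (f r) ^+ 10)%R) <=
    ((2 * (2 * E + 1)) ^+ 4 * (6 * E))%:E)%E.
Proof.
move=> E0 [acf f1 _ _] /energy_le[A B]; set M := 2 * (2 * E + 1).
have M0 : 0 < M by rewrite /M; lra.
have M40 : 0 < M ^+ 4 by rewrite exprn_gt0.
have w0 n r : (0 <= (4 * pi * r ^+ 2 * cnorm (f r) ^+ n)%:E)%E.
  by rewrite lee_fin mulr_ge0 ?weight_ge0 ?exprn_ge0 ?cnorm_ge0.
apply: (@le_trans _ _ ((M ^+ 4)%:E *
    integral_Omega (fun r => (cnorm (f r) ^+ 6)%R))%E); last first.
  by rewrite [leRHS]EFinM lee_pmul2l.
apply: le_trans; last by apply: lower_integralZl.
apply: lower_integral_le => // r.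
  by move=> _; rewrite mule_ge0// lee_fin ltW.
rewrite /radii/= in_itv/= andbT => r1.
rewrite -EFinM lee_fin [leRHS]mulrCA ler_wpM2l ?weight_ge0//.
rewrite (exprD _ 4 6) ler_wpM2r ?exprn_ge0 ?cnorm_ge0//.
rewrite lerXn2r ?nnegrE ?cnorm_ge0 ?(ltW M0)//.
by apply: radial_sobolev A r1 => //; lra.
Qed.

Lemma L10_norm_le (u : R -> R -> R[i]) (E a b : R) : 0 <= E -> a <= b ->
  (forall t, a <= t <= b -> in_dotH10 (u t) /\ (energy (u t) <= E%:E)%E) ->
  (L10_norm `[a, b] u <=
    (((2 * (2 * E + 1)) ^+ 4 * (6 * E) * (b - a)) `^ 10^-1)%:E)%E.
Proof.
move=> E0 ab uE; set C := _ * (6 * E).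
have C0 : 0 <= C by rewrite mulr_ge0 ?exprn_ge0//; lra.
have I0 t : (0 <= integral_Omega (fun r => (cnorm (u t r) ^+ 10)%R))%E.
  by apply: integral_Omega_ge0 => r; rewrite exprn_ge0 ?cnorm_ge0.
rewrite /L10_norm -poweR_EFin; apply: gt0_ler_poweR.
- by rewrite invr_ge0.
- rewrite in_itv; apply/andP; split; last exact: leey.
  exact: integral_ge0.
- by rewrite in_itv/= leey andbT lee_fin mulr_ge0 ?subr_ge0.
apply: (@le_trans _ _ (\int[mu]_(t in `[a, b]) C%:E)%E).
  apply: lower_integral_le => [//|t _|t _|t /=]; first exact: I0.
    by rewrite lee_fin.
  rewrite in_itv/= => /uE[ut utE].
  exact: integral_Omega_L10_le.
rewrite integral_cst// [leRHS]EFinM lee_wpmul2l ?lee_fin//.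
rewrite [leLHS](lebesgue_measure_itv `[a, b])/= lte_fin; case: ltP => // ba.
by rewrite lee_fin subr_ge0.
Qed.

End RadialSobolev.

Theorem lemma3p4 (R : realType) (E : R) (E_gt0 : 0 < E) :
  exists2 eps0 : R, 0 < eps0 &
  forall eta0 : R, 0 < eta0 -> eta0 < eps0 ->
  exists2 eps1 : R, 0 < eps1 &
  forall eta1 : R, 0 < eta1 -> eta1 < eps1 ->
  forall (tm tp : R) (u : R -> R -> R[i]),
    tm <= tp ->
    is_solution `[tm, tp] u ->
    (forall t, `[tm, tp]%classic t -> (energy (u t) <= E%:E)%E) ->
  forall (J : nat) (s : nat -> R),
    s 0%N = tm -> s J = tp ->
    (forall j, (j < J)%N -> s j <= s j.+1) ->
    (forall j, (j < J)%N ->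
       (eta0%:E < L10_norm `[s j, s j.+1] u)%E /\
       (L10_norm `[s j, s j.+1] u <= (2 * eta0)%:E)%E) ->
  forall j, (j < J)%N ->
    unexceptional eta0 tm tp u `[s j, s j.+1] ->
    eta1 < s j.+1 - s j.
Proof.
pose C := (2 * (2 * E + 1)) ^+ 4 * (6 * E).
have C0 : 0 < C by rewrite mulr_gt0 ?exprn_gt0//; lra.
exists 1 => // eta0 eta00 _; exists (eta0 ^+ 10 / C).
  by rewrite divr_gt0 ?exprn_gt0.
move=> eta1 _ eta1lt tm tp u _ [u_cont _] uE J s s0 sJ s_le sL j jJ _.
have s_homo i k : (i <= k)%N -> (k <= J)%N -> s i <= s k.
  move=> /subnK <-; elim: (k - i)%N => [//|m IH] mJ.
  by rewrite addSn (le_trans (IH (ltnW mJ)))// s_le.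
have [jL _] := sL j jJ.
rewrite ltNge; apply/negP => short.
have sub t : s j <= t <= s j.+1 -> `[tm, tp]%classic t.
  move=> /andP[jt tj]; rewrite /= in_itv/= -s0 -sJ.
  rewrite (le_trans (s_homo 0%N j _ _) jt)// ?(ltnW jJ)//.
  by rewrite (le_trans tj)// s_homo.
have u_in t : s j <= t <= s j.+1 -> in_dotH10 (u t) /\ (energy (u t) <= E%:E)%E.
  by move=> /sub It; split; [case: (u_cont t It)|exact: uE].
have := lt_le_trans jL (L10_norm_le (ltW E_gt0) (s_le j jJ) u_in).
rewrite -/C lte_fin ltNge => /negP; apply.
have eta0E : eta0 = (eta0 ^+ 10) `^ 10^-1.
  by rewrite -powR_mulrn ?(ltW eta00)// -powRrM divff// powRr1// ltW.
rewrite [leRHS]eta0E; apply: ge0_ler_powR.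
- by rewrite invr_ge0.
- by rewrite nnegrE mulr_ge0 ?(ltW C0)// subr_ge0 s_le.
- by rewrite nnegrE exprn_ge0// ltW.
rewrite mulrC -ler_pdivlMr//.
exact: le_trans short (ltW eta1lt).
Qed.
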